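(* Let $G$ be a maximal $3$-$\gamma_{c}$-vertex critical graph with independence number $\alpha$ and connectivity $\kappa$. If $\alpha=\kappa$, then for every minimum vertex cut set $S$ of $G$ (i.e. $|S|=\kappa$ and $G-S$ is disconnected), the graph $G-S$ has at least one component consisting of a single vertex.
   Context: All graphs are finite, simple and connected. A set $D\subseteq V(G)$ is a connected dominating set of $G$ if every vertex of $G$ is in $D$ or adjacent to a vertex of $D$, and $G[D]$ is connected; $\gamma_{c}(G)$ is the minimum cardinality of such a set. $G$ is $k$-$\gamma_{c}$-edge critical if $\gamma_{c}(G)=k$ and $\gamma_{c}(G+uv)<k$ for every pair of non-adjacent vertices $u,v$. A $2$-connected graph $G$ is $k$-$\gamma_{c}$-vertex critical if $\gamma_{c}(G)=k$ and $\gamma_{c}(G-v)<k$ for every $v\in V(G)$. $G$ is maximal $k$-$\gamma_{c}$-vertex critical if it is both $k$-$\gamma_{c}$-edge critical and $k$-$\gamma_{c}$-vertex critical. *)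

(* Defs.v *)
From mathcomp Require Import all_boot.
Set Implicit Arguments. Unset Strict Implicit. Unset Printing Implicit Defensive.

Section Graphs.
Variable V : finType.
Implicit Types (e : rel V) (W D S : {set V}).

Definition simple_graph e := symmetric e /\ irreflexive e.

Definition restr e W : rel V := [rel x y | [&& e x y, x \in W & y \in W]].

(* G[W] is connected (the empty graph counts as connected) *)
Definition connected_set e W : bool :=
  [forall x in W, forall y in W, connect (restr e W) x y].

Definition component e W x : {set V} :=
  [set y in W | connect (restr e W) x y].

Definition dominates e W D : bool :=
  [forall x in W, (x \in D) || [exists y in D, e x y]].

Definition cds e W D : bool :=
  [&& D \subset W, dominates e W D & connected_set e D].

(* connected domination number of G[W]: minimum size of a CDS of G[W]
   (default #|W| when G[W] has none, which never happens for connected G[W]) *)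
Definition gammac e W : nat :=
  \big[minn/#|W|]_(D : {set V} | cds e W D) #|D|.

Definition add_edge e u v : rel V :=
  [rel x y | [|| e x y, (x == u) && (y == v) | (x == v) && (y == u)]].

Definition edge_critical e k : Prop :=
  gammac e setT = k /\
  forall u v, u != v -> ~~ e u v -> gammac (add_edge e u v) setT < k.

Definition k_connected e k : Prop :=
  k < #|V| /\ forall S, #|S| < k -> connected_set e (~: S).

Definition vertex_critical e k : Prop :=
  k_connected e 2 /\ gammac e setT = k /\
  forall v, gammac e [set~ v] < k.

Definition maximal_vertex_critical e k : Prop :=
  edge_critical e k /\ vertex_critical e k.

Definition independent e S : bool := [forall x in S, forall y in S, ~~ e x y].

Definition alpha e : nat := \max_(S : {set V} | independent e S) #|S|.

Definition vertex_cut e S : bool := ~~ connected_set e (~: S).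

Definition kappa e : nat :=
  \big[minn/#|V|.-1]_(S : {set V} | vertex_cut e S) #|S|.

End Graphs.

(* Main.v *)
(** Suppose that no component of G - S is a single vertex.  Call (a, b; v) an
    arc when a and b are adjacent and dominate everything except v; such a pair
    meets S, since otherwise it lies in one component and dominates no other.
    By vertex criticality every v ends an arc, so a vertex outside S is never adjacent to all of S,
    and it is impossible that all but one element of S dominate a component.
    Edge criticality makes any independent set I with at least three vertices a
    tournament: of two a, b in I, one, say a, starts an arc (a, z; b), and then
    b is the only vertex of I that z misses.  Take |I| = |S|, so that
    |I \ S| = |S \ I|.  Arcs starting outside a component C give distinct
    elements of S \ I, each missing exactly one vertex of I and no other vertex
    of C, for all but one vertex f of I \ S.  So S \ I has a single unlabelled element y, and
    following the arcs around f and y contradicts one of the two facts above,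
    or the fact that two vertices in different components cannot both miss the
    same single element of S. *)
Require Import Defs.
From mathcomp Require Import all_boot.
Set Implicit Arguments. Unset Strict Implicit. Unset Printing Implicit Defensive.

(** * Closed neighbourhoods and arcs *)

Section ClosedNeighbourhoods.
Variables (V : finType) (e : rel V).

Definition cov (u v : V) : bool := (u == v) || e u v.

Definition dom2 (a b v : V) : Prop :=
  [/\ e a b, ~~ cov a v, ~~ cov b v & forall w, w != v -> cov a w || cov b w].

End ClosedNeighbourhoods.

(* [same] stands for being in the same component of G - S. *)
Section Cut.
Variables (V : finType) (e same : rel V) (S : {set V}).

Hypothesis e_sym : symmetric e.
Hypothesis e_irr : irreflexive e.
Hypothesis same_refl : reflexive same.
Hypothesis same_sym : symmetric same.
Hypothesis same_trans : transitive same.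
Hypothesis same_adj : forall u v, u \notin S -> v \notin S -> e u v -> same u v.
Hypothesis other_component : forall u, exists2 v, v \notin S & ~~ same u v.
Hypothesis nbr_outside :
  forall u, u \notin S -> exists2 v, v \notin S & e u v.
Hypothesis nbr_of_cut : forall s u, s \in S -> u \notin S ->
  exists v, [/\ v \notin S, same u v & e s v].
Hypothesis crit_vertex : forall v, exists a b, dom2 e a b v.
Hypothesis crit_edge : forall u v, ~~ cov e u v ->
  [\/ forall w, cov e u w || cov e v w, exists z, dom2 e u z v
    | exists z, dom2 e v z u].


Local Notation N := (cov e).
Local Notation dom2 := (dom2 e).

(** * How arcs meet the cut *)

Lemma covN u v : u != v -> ~~ e u v -> ~~ N u v.
Proof. by move=> uv nuv; rewrite /cov negb_or uv. Qed.

Lemma cov_e u v : u != v -> N u v -> e u v.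
Proof. by rewrite /cov => /negPf->. Qed.

Lemma e_neq u v : e u v -> u != v.
Proof. by move=> euv; apply/eqP => uv; rewrite uv e_irr in euv. Qed.

Lemma neqS u v : u \in S -> v \notin S -> u != v.
Proof. by move=> uS; apply: contraNneq => <-. Qed.

Lemma diff_covN u v : u \notin S -> v \notin S -> ~~ same u v -> ~~ N u v.
Proof.
move=> uS vS nuv; apply: covN; first by apply: contraNneq nuv => ->.
by apply: contra nuv; apply: same_adj.
Qed.

Lemma dom2C a b v : dom2 a b v -> dom2 b a v.
Proof.
by case=> eab av bv dom; split=> //; [rewrite e_sym | move=> w /dom; rewrite orbC].
Qed.

Lemma dom2_cov a b v w : dom2 a b v -> w != v -> ~~ N a w -> N b w.
Proof. by case=> _ _ _ dom /dom; case: (N a w). Qed.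

Lemma dom2_Ne a b v : dom2 a b v -> ~~ e a v /\ ~~ e b v.
Proof. by case=> _; rewrite /cov !negb_or => /andP[_ ->] /andP[_ ->]. Qed.

Lemma dom2_neq a b v : dom2 a b v -> a != v /\ b != v.
Proof. by case=> _; rewrite /cov !negb_or => /andP[-> _] /andP[-> _]. Qed.

Lemma dom2S a b v : dom2 a b v -> (a \in S) || (b \in S).
Proof.
move=> D; apply: contraT; rewrite negb_or => /andP[aS bS].
have [eab _ _ dom] := D.
have sab := same_adj aS bS eab.
have [c cS nac] := other_component a.
have far d : d \notin S -> same c d -> d != v -> False.
  move=> dS scd dv.
  have nad : ~~ same a d.
    by apply: contra nac => sad; apply: same_trans sad _; rewrite same_sym.
  have nbd : ~~ same b d by apply: contra nad; apply: same_trans.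
  by have := dom d dv; rewrite (negPf (diff_covN aS dS nad)) (negPf (diff_covN bS dS nbd)).
(* [c d] is an edge of another component; at most one of its ends is [v], and [a], [b] dominate
   neither. *)
have [d dS ecd] := nbr_outside cS.
have [cv|cv] := eqVneq c v; last by case: (far c).
by case: (far d) => //; [apply: same_adj | rewrite -cv eq_sym e_neq].
Qed.

Lemma dom2_inS a b v : dom2 a b v -> a \notin S -> b \in S.
Proof. by move=> /dom2S /orP[->|]. Qed.

(** Outside [S], [a] covers only vertices of its own component, so [b] has to cover the others up to
    [v]. *)
Lemma dom2_full a b v u :
  dom2 a b v -> a \notin S -> u \notin S -> u != v -> ~~ same a u -> e b u.
Proof.
move=> D aS uS uv nau; have bS := dom2_inS D aS.
apply: cov_e; first exact: neqS.
exact: dom2_cov D uv (diff_covN aS uS nau).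
Qed.

Lemma crit_vertexS v : exists s r, s \in S /\ dom2 s r v.
Proof.
have [a [b D]] := crit_vertex v.
by case/orP: (dom2S D) => ?; [exists a, b | exists b, a; split=> //; apply: dom2C].
Qed.

(** An arc ending at [v] has an end in [S], and that end misses [v]. *)
Lemma no_common_nbr v : ~ (forall s, s \in S -> e s v).
Proof.
move=> all; have [s [r [sS D]]] := crit_vertexS v.
by have [] := dom2_Ne D; rewrite all.
Qed.

(** A neighbour of [y] in that component, which exists for every element of [S], would be adjacent
    to all of [S]. *)
Lemma no_full_but_one c y : c \notin S -> y \in S ->
  ~ (forall s v, s \in S -> s != y -> v \notin S -> same c v -> e s v).
Proof.
move=> cS yS full; have [v [vS cv yv]] := nbr_of_cut yS cS.
apply: (@no_common_nbr v) => s sS.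
by have [->//|sy] := eqVneq s y; apply: full.
Qed.

Lemma crit_far u v : u \notin S -> v \notin S -> ~~ same u v ->
  [\/ forall w, N u w || N v w, exists2 z, z \in S & dom2 u z v
    | exists2 z, z \in S & dom2 v z u].
Proof.
move=> uS vS nuv; case: (crit_edge (diff_covN uS vS nuv)) => [dom|[z D]|[z D]].
- exact: Or31.
- by apply: Or32; exists z; rewrite // (dom2_inS D).
- by apply: Or33; exists z; rewrite // (dom2_inS D).
Qed.

(** Neither vertex covers [y], so edge criticality gives an arc from one to the other through some
    [z] in [S]. Being adjacent to its start, [z] is not [y], hence it is adjacent to its end too. *)
Lemma not_both_miss_one u v y : y \in S -> u \notin S -> v \notin S ->
  ~~ same u v -> ~~ e u y -> ~~ e v y ->
  (forall s, s \in S -> s != y -> e s u && e s v) -> False.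
Proof.
move=> yS uS vS nuv uy vy all.
have toy a b z : a \notin S -> ~~ e a y ->
    (forall s, s \in S -> s != y -> e s b) -> z \in S -> dom2 a z b -> False.
  move=> aS ay allb zS D; have [eaz _ _ _] := D.
  have [zy|zy] := eqVneq z y; first by rewrite zy (negPf ay) in eaz.
  by have [_] := dom2_Ne D; rewrite allb.
case: (crit_far uS vS nuv) => [dom|[z zS]|[z zS]].
- by move: (dom y); rewrite /cov (negPf uy) (negPf vy) ![_ == y]eq_sym
    !(negPf (neqS yS _)).
- by apply: toy => // s sS sy; have /andP[] := all s sS sy.
- by apply: toy => // s sS sy; have /andP[] := all s sS sy.
Qed.

(** If [S = {a, s}], an arc ending at [a] joins [s] to a vertex outside [S], so [s] dominates every
    component but that of this vertex. Excluding size 2 later gives [I] a third vertex. *)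
Lemma card_cut_neq2 : #|S| = 2 -> False.
Proof.
move=> S2; have /set0Pn[a aS] : S != set0 by rewrite -card_gt0 S2.
have [s [r [sS D]]] := crit_vertexS a; have [sa ra] := dom2_neq D.
have [esr _ _ _] := D.
have defS : S = [set a; s].
  apply/eqP; rewrite eq_sym eqEcard S2 cards2 eq_sym sa andbT.
  by apply/subsetP=> x /set2P[]->.
have rS : r \notin S.
  by rewrite defS !inE negb_or ra eq_sym e_neq.
have [c cS nrc] := other_component r.
apply: (no_full_but_one cS aS) => x v; rewrite {1}defS => /set2P[->|-> _ vS cv].
  by rewrite eqxx.
apply: (dom2_full (dom2C D)) => //; first by rewrite eq_sym neqS.
by apply: contra nrc => rv; apply: same_trans rv _; rewrite same_sym.
Qed.

(** * Arcs on an independent set of the size of the cut *)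

Section Independent.
Variable I : {set V}.
Hypothesis I_indep : forall x y, x \in I -> y \in I -> ~~ e x y.
Hypothesis card_I : #|I| = #|S|.
Hypothesis I_gt2 : 2 < #|I|.

(** A third vertex of [I] is covered by neither, so [a] and [b] do not dominate and an arc
    remains. *)
Lemma arc_total a b : a \in I -> b \in I -> a != b ->
  (exists z, dom2 a z b) \/ (exists z, dom2 b z a).
Proof.
move=> aI bI ab.
case: (crit_edge (covN ab (I_indep aI bI))) => [dom||]; [|by left|by right].
have /set0Pn[c] : I :\ a :\ b != set0.
  rewrite -card_gt0; have := cardsD1 b (I :\ a); have := cardsD1 a I.
  by rewrite aI !inE eq_sym ab bI /= => h1 h2; move: I_gt2; rewrite h1 h2.
rewrite !inE => /and3P[cb ca cI].
by move: (dom c); rewrite /cov !(negPf (I_indep _ _)) // ![_ == c]eq_sym (negPf ca) (negPf cb).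
Qed.

Lemma arc_notin a z b : a \in I -> dom2 a z b -> z \notin I.
Proof.
by move=> aI [eaz _ _ _]; apply: contraL eaz => zI; apply: I_indep.
Qed.

(** [a] covers no other vertex of [I], so [z] has to cover all of them but [b]. *)
Lemma arc_adj a z b c : a \in I -> dom2 a z b -> c \in I -> c != b -> e z c.
Proof.
move=> aI D cI cb; have [eaz _ _ _] := D.
have [->|ca] := eqVneq c a; first by rewrite e_sym.
apply: cov_e; first by apply: contraNneq (arc_notin aI D) => ->.
by apply: dom2_cov D cb (covN _ (I_indep aI cI)); rewrite eq_sym.
Qed.

Lemma card_setD_cut : #|I :\: S| = #|S :\: I|.
Proof. by rewrite !cardsD card_I setIC. Qed.

(** Such a [z] serves as a label of [b] relative to the component of [c]; as it determines [b]
    within [I], labels are distinct. *)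
Definition misses_only (c b z : V) : bool :=
  [&& z \in S :\: I, ~~ e z b, [forall d in I, (d != b) ==> e z d]
    & [forall v, [&& v \notin S, same c v & v != b] ==> e z v]].

Lemma misses_onlyP c b z : reflect
  [/\ z \in S /\ z \notin I, ~~ e z b, forall d, d \in I -> d != b -> e z d
    & forall v, v \notin S -> same c v -> v != b -> e z v]
  (misses_only c b z).
Proof.
apply: (iffP and4P) => -[zX zb zI zC]; split=> //.
- by case/setDP: zX.
- by move=> d dI; apply/implyP; move/forall_inP: zI; apply.
- by move=> v vS cv vb; move/forallP/(_ v)/implyP: zC; apply; rewrite vS cv.
- by case: zX => zS zI'; rewrite inE zI'.
- by apply/forall_inP=> d dI; apply/implyP; apply: zI.
- by apply/forallP=> v; apply/implyP=> /and3P[vS cv vb]; apply: zC.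
Qed.

Lemma arc_misses_only c a z b : a \in I -> a \notin S -> ~~ same c a ->
  dom2 a z b -> misses_only c b z.
Proof.
move=> aI aS ca D; apply/misses_onlyP; split.
- by rewrite (dom2_inS D aS) (arc_notin aI D).
- by have [] := dom2_Ne D.
- by move=> d; apply: arc_adj D.
move=> v vS cv vb; apply: (dom2_full D) => //.
by apply: contra ca => av; apply: same_trans cv _; rewrite same_sym.
Qed.

(** Of two vertices of [I :\: S] outside the component of [c], one sends an arc to the other and so
    labels it. Hence at most one vertex is unlabelled, and [#|I :\: S| = #|S :\: I|] leaves a single
    [y]. *)
Lemma cut_labelling c g : g \in I -> g \notin S -> ~~ same c g ->
  (forall b, b \in I -> b \notin S -> same c b ->
     exists z, misses_only c b z) ->
  exists f y (x : V -> V),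
    [/\ [/\ f \in I, f \notin S & ~~ same c f],
        y \in S /\ y \notin I,
        forall b, b \in I -> b \notin S -> b != f ->
          misses_only c b (x b) /\ x b != y
      & forall z, z \in S -> z \notin I -> z != y ->
          exists b, [/\ b \in I, b \notin S, b != f & z = x b]].
Proof.
move=> gI gS cg in_arc.
pose good b := [exists z, misses_only c b z].
have goodP a z b : a \in I -> a \notin S -> ~~ same c a -> dom2 a z b -> good b.
  by move=> aI aS ca D; apply/existsP; exists z; apply: arc_misses_only D.
have good_in b : b \in I -> b \notin S -> same c b -> good b.
  by move=> bI bS cb; apply/existsP/in_arc.
have [f [[fI fS cf] all_good]] : exists f, [/\ f \in I, f \notin S & ~~ same c f] /\
    forall b, b \in I -> b \notin S -> b != f -> good b.
  have [f /and3P[fI fS nf]|all] := pickP [pred f | [&& f \in I, f \notin S & ~~ good f]].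
    have cf : ~~ same c f by apply: contra nf; apply: good_in.
    exists f; split=> // b bI bS bf; apply: contraT => nb.
    have cb : ~~ same c b by apply: contra nb; apply: good_in.
    case: (arc_total bI fI bf) => -[z D].
      by rewrite (goodP b z) in nf.
    by rewrite (goodP f z) in nb.
  (* If every vertex has a label, [g] acts as [f] and its label is disregarded. *)
  exists g; split=> // b bI bS _; apply: contraT => nb.
  by have := all b; rewrite /= bI bS nb.
(* The default [b] never occurs on [I :\: S] without [f]. *)
pose x b := odflt b [pick z | misses_only c b z].
have xP b : b \in I -> b \notin S -> b != f -> misses_only c b (x b).
  move=> bI bS bf; rewrite /x; case: pickP => //= none.
  by have /existsP[z] := all_good b bI bS bf; rewrite none.
have x_inj : {in (I :\: S) :\ f &, injective x}.
  move=> b b'; rewrite !inE => /and3P[bf bS bI] /and3P[bf' bS' bI'] xx.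
  have /misses_onlyP[_ nb _ _] := xP b bI bS bf.
  have /misses_onlyP[_ _ all _] := xP b' bI' bS' bf'.
  by apply/eqP; apply: contraNT nb; rewrite xx; apply: all.
have x_sub : x @: ((I :\: S) :\ f) \subset S :\: I.
  apply/subsetP=> _ /imsetP[b + ->]; rewrite !inE => /and3P[bf bS bI].
  by have /misses_onlyP[[-> ->]] := xP b bI bS bf.
have card_x : #|S :\: I| = #|x @: ((I :\: S) :\ f)|.+1.
  by rewrite card_in_imset // -card_setD_cut (cardsD1 f) !inE fI fS.
have /set0Pn[y] : (S :\: I) :\: x @: ((I :\: S) :\ f) != set0.
  by rewrite -card_gt0 cardsD (setIidPr x_sub) card_x subSnn.
rewrite in_setD => /andP[y_notin yX]; have yX' := yX.
move: yX' => /setDP[yS yI]; exists f, y, x; split=> //.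
  move=> b bI bS bf; split; first exact: xP.
  by apply: contraNneq y_notin => <-; apply: imset_f; rewrite !inE bf bS bI.
move=> z zS zI zy.
have im_eq : x @: ((I :\: S) :\ f) = (S :\: I) :\ y.
  apply/eqP; rewrite eqEcard; apply/andP; split.
    apply/subsetP=> w wx; rewrite in_setD1 (subsetP x_sub) // andbT.
    by apply: contraNneq y_notin => <-.
  by move: card_x; rewrite (cardsD1 y (S :\: I)) yX add1n => -[->].
have : z \in x @: ((I :\: S) :\ f) by rewrite im_eq !inE zy zI.
by case/imsetP=> b; rewrite !inE => /and3P[bf bS bI] ->; exists b.
Qed.


(* If I = S, all middle vertices of arcs lie outside S, and those of consecutive
   arcs are adjacent; but every component must contain the middle vertex of an
   arc starting at one of its at least two non-dominating elements of S. *)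
Lemma not_sub_cut : ~ (I \subset S).
Proof.
move=> subI; have IS : I = S by apply/eqP; rewrite eqEcard subI card_I leqnn.
pose nonfull d t := [exists v, [&& v \notin S, same d v & ~~ e t v]].
(* At least two elements of [S] fail to dominate the component of [d]; an arc between them is
   taken. *)
have one_arc d : d \notin S -> exists t t' z,
    [/\ t \in S, nonfull d t, t' \in S & dom2 t z t'].
  move=> dS; have other_nonfull a : a \in S -> exists t, [/\ t \in S, t != a & nonfull d t].
    move=> aS; have [t /and3P[tS ta nt]|all] :=
      pickP [pred t | [&& t \in S, t != a & nonfull d t]]; first by exists t.
    case: (no_full_but_one dS aS) => t v tS ta vS dv; apply: contraT => ntv.
    by have := all t; rewrite /= tS ta /nonfull; case: existsP => // -[];
      exists v; rewrite vS dv.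
  have [s0 s0S] : exists s0, s0 \in S.
    by apply/set0Pn; rewrite -card_gt0 -IS; case: #|I| I_gt2.
  have [t [tS _ nt]] := other_nonfull s0 s0S.
  have [t' [t'S tt' nt']] := other_nonfull t tS.
  move: (arc_total (a := t) (b := t')); rewrite IS eq_sym => /(_ tS t'S tt')[] [z D].
    by exists t, t', z.
  by exists t', t, z.
have arcS t z t' : t \in S -> dom2 t z t' -> z \notin S.
  by rewrite -IS; apply: arc_notin.
(* With [z] in another component, [t] would dominate the component of [d]. *)
have arc_comp d t t' z : t \in S -> nonfull d t -> t' \in S -> dom2 t z t' -> same d z.
  move=> tS /existsP[v /and3P[vS dv]] + t'S D; apply: contraNT => dz.
  apply: (dom2_full (dom2C D)) => //; first exact: arcS D.
    by rewrite eq_sym neqS.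
  by apply: contra dz => zv; apply: same_trans dv _; rewrite same_sym.
(* [t'] misses [z], so [z'] must cover it. *)
have chain t z t' z' t'' : t \in S -> t' \in S -> t'' \in S ->
    dom2 t z t' -> dom2 t' z' t'' -> same z z'.
  move=> tS t'S t''S D D'; have zS := arcS _ _ _ tS D; have z'S := arcS _ _ _ t'S D'.
  apply: contraT; rewrite same_sym => zz'.
  suff : N z' z by rewrite (negPf (diff_covN z'S zS zz')).
  apply: dom2_cov D' _ _; first by rewrite eq_sym neqS.
  by apply: covN; [exact: neqS | rewrite e_sym; have [] := dom2_Ne D].
have /set0Pn[s0 s0S] : S != set0 by rewrite -card_gt0 -IS; case: #|I| I_gt2.
have [d dS _] := other_component s0; have [d' d'S dd'] := other_component d.
have [t [t' [z [tS nt t'S D]]]] := one_arc d dS.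
have [r [r' [z' [rS nr r'S D']]]] := one_arc d' d'S.
have dz := arc_comp _ _ _ _ tS nt t'S D.
have d'z' := arc_comp _ _ _ _ rS nr r'S D'.
have far w w' : same d w -> same d' w' -> ~~ same w w'.
  move=> dw d'w'; apply: contra dd' => ww'; apply: same_trans dw _.
  by apply: same_trans ww' _; rewrite same_sym.
have tr : t != r.
  apply: contraTneq d'z' => tr; rewrite -tr in nr.
  by have := far _ _ dz (arc_comp _ _ _ _ tS nr t'S D); rewrite same_refl.
(* The middle vertex [w] lies in the component attached to the start of its arc, and by [chain] also
   in the other one. *)
move: (arc_total (a := t) (b := r)); rewrite IS => /(_ tS rS tr)[] [w Dw].
  have := far _ _ (arc_comp _ _ _ _ tS nt rS Dw) d'z'.
  by rewrite (chain _ _ _ _ _ tS rS r'S Dw D').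
have := far _ _ dz (arc_comp _ _ _ _ rS nr tS Dw).
by rewrite same_sym (chain _ _ _ _ _ rS tS t'S Dw D).
Qed.

(** * Refuting the labellings *)

Section Labelled.
Variables (c f y : V) (x : V -> V).
Hypothesis cS : c \notin S.
Hypothesis fI : f \in I.
Hypothesis fS : f \notin S.
Hypothesis cf : ~~ same c f.
Hypothesis yS : y \in S.
Hypothesis yI : y \notin I.
(* [x b] is the label of [b] in I \ S, and [y] is the only unlabelled element of S \ I. *)
Hypothesis x_misses : forall b, b \in I -> b \notin S -> b != f ->
  misses_only c b (x b) /\ x b != y.
Hypothesis x_onto : forall z, z \in S -> z \notin I -> z != y ->
  exists b, [/\ b \in I, b \notin S, b != f & z = x b].

Lemma label_cases z : z \in S -> z \notin I -> z = y \/
  exists b, [/\ b \in I, b \notin S, b != f & z = x b].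
Proof.
by move=> zS zI; have [->|zy] := eqVneq z y; [left | right; apply: x_onto].
Qed.

Lemma label_miss b : b \in I -> b \notin S -> b != f -> ~~ e (x b) b.
Proof. by move=> bI bS bf; have [/misses_onlyP[]] := x_misses bI bS bf. Qed.

Lemma label_adj b d : b \in I -> b \notin S -> b != f -> d \in I -> d != b -> e (x b) d.
Proof. by move=> bI bS bf; have [/misses_onlyP[_ _ + _] _] := x_misses bI bS bf; apply. Qed.

Lemma label_full b v : b \in I -> b \notin S -> b != f ->
  v \notin S -> same c v -> v != b -> e (x b) v.
Proof. by move=> bI bS bf; have [/misses_onlyP[_ _ _ +] _] := x_misses bI bS bf; apply. Qed.

Lemma label_in b : b \in I -> b \notin S -> b != f -> x b \in S.
Proof. by move=> bI bS bf; have [/misses_onlyP[[]]] := x_misses bI bS bf. Qed.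

Lemma label_base b : b \in I -> b \notin S -> b != f -> e (x b) f.
Proof. by move=> bI bS bf; apply: label_adj => //; rewrite eq_sym. Qed.

Lemma label_cut b t : b \in I -> b \notin S -> b != f -> t \in I -> t \in S -> e (x b) t.
Proof. by move=> bI bS bf tI tS; apply: label_adj => //; apply: neqS. Qed.

(* All elements of S but y and at most one t dominate C; then t sends an arc to f
   through y or through a vertex of C, and both are refuted. *)
Lemma no_labelling_avoiding_I :
  (forall b, b \in I -> b \notin S -> ~~ same c b) ->
  (forall b, b \in I -> b \notin S -> same f b) -> False.
Proof.
move=> noC oneC.
have fc v : same c v -> ~~ same f v.
  by move=> cv; apply: contra cf => fv; apply: same_trans cv _; rewrite same_sym.
have ltI v b : same c v -> b \in I -> b \notin S -> v != b.
  by move=> cv bI bS; apply: contraTneq cv => ->; apply: noC.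
have adjJ z b : z \notin S -> b \in I -> b \notin S -> e z b -> ~~ same c z.
  move=> zS bI bS ezb; apply: contra (noC b bI bS) => cz.
  by apply: same_trans cz _; apply: same_adj.
have sep z v : ~~ same c z -> same c v -> ~~ same z v.
  by move=> cz cv; apply: contra cz => zv; apply: same_trans cv _; rewrite same_sym.
have xfull b v : b \in I -> b \notin S -> b != f -> v \notin S -> same c v -> e (x b) v.
  by move=> bI bS bf vS cv; apply: label_full => //; apply: ltI.
have f_arc t z : t \in I -> t \in S -> dom2 f z t -> z = y.
  move=> tI tS D; case: (label_cases (dom2_inS D fS) (arc_notin fI D)) => // -[b [bI bS bf zb]].
  by have [_] := dom2_Ne D; rewrite zb label_cut.
(* Given [(f, y; t)], both [y] and the labels dominate the component of [c]; so does every other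
   element of [I] in [S], against [no_full_but_one]. *)
have no_f_arc t z : t \in I -> t \in S -> ~ dom2 f z t.
  move=> tI tS D; have zy := f_arc t z tI tS D; rewrite {z}zy in D.
  have [efy _ _ _] := D.
  have yfull v : v \notin S -> same c v -> e y v.
    by move=> vS cv; apply: (dom2_full D) => //; [rewrite eq_sym neqS | exact: fc].
  apply: (no_full_but_one cS tS) => s v sS st vS cv.
  have [sI|sI] := boolP (s \in I); last first.
    by case: (label_cases sS sI) => [->|[b [bI bS bf ->]]]; [apply: yfull | apply: xfull].
  case: (arc_total fI sI) => [|[z D']|[z D']].
  - by rewrite eq_sym neqS.
  - by have [_] := dom2_Ne D'; rewrite (f_arc s z) // (arc_adj fI D).
  have [_ zf] := dom2_Ne D'; have zI := arc_notin sI D'.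
  have [zS|zS] := boolP (z \in S).
    case: (label_cases zS zI) zf => [->|[b [bI bS bf ->]]]; last by rewrite label_base.
    by rewrite e_sym efy.
  have [cz|cz] := boolP (same c z); last first.
    apply: (dom2_full (dom2C D')) => //; [exact: ltI | exact: sep].
  exfalso; apply: (@no_common_nbr z) => s' s'S; have [s'I|s'I] := boolP (s' \in I).
    by rewrite e_sym (arc_adj sI D') // neqS.
  by case: (label_cases s'S s'I) => [->|[b [bI bS bf ->]]]; [apply: yfull | apply: xfull].
have arc_f t : t \in I -> t \in S -> exists z, dom2 t z f.
  move=> tI tS; case: (arc_total tI fI) => [|//|[z /no_f_arc[]]//]; exact: neqS.
pose nonfull t := [exists v, [&& v \notin S, same c v & ~~ e t v]].
have fullP t v : ~~ nonfull t -> v \notin S -> same c v -> e t v.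
  move=> nt vS cv; apply: contraNT nt => ntv.
  by apply/existsP; exists v; rewrite vS cv.
(* [z] is no label, as labels are adjacent to [f]. If outside [S], it lies in the component of [c],
   which [t] would dominate otherwise; it misses [y] by [no_common_nbr]. Being adjacent to all of
   [I] but [f], it leaves no vertex of [I] outside [S] except [f]. *)
have nonfull_arc t z : t \in I -> t \in S -> nonfull t -> dom2 t z f -> e t y /\
    (z = y \/ [/\ z \notin S, same c z, ~~ e z y & forall b, b \in I -> b \notin S -> b = f]).
  move=> tI tS nt D; have [_ zf] := dom2_Ne D; have [etz _ _ _] := D.
  have zI := arc_notin tI D; have [zS|zS] := boolP (z \in S).
    case: (label_cases zS zI) => [zy|[b [bI bS bf zx]]]; last by rewrite zx label_base in zf.
    by rewrite -zy; split=> //; left.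
  have cz : same c z.
    apply: contraLR nt => cz; apply/existsP => -[v /and3P[vS cv /negP[]]].
    by apply: (dom2_full (dom2C D)) => //; [exact: ltI | exact: sep].
  have onlyf b : b \in I -> b \notin S -> b = f.
    move=> bI bS; apply/eqP; apply: contraTT cz => bf.
    by apply: (adjJ z b) => //; apply: arc_adj D _ _.
  have zy : ~~ e z y.
    apply/negP=> ezy; apply: (@no_common_nbr z) => s sS; have [sI|sI] := boolP (s \in I).
      by rewrite e_sym (arc_adj tI D) // neqS.
    case: (label_cases sS sI) => [->|[b [bI bS /eqP[]]]]; first by rewrite e_sym.
    exact: onlyf.
  split; last by right.
  apply: cov_e; first by apply: contraNneq yI => <-.
  apply: dom2_cov (dom2C D) _ _; first exact: neqS.
  by apply: covN => //; rewrite eq_sym neqS.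
have nonfull_y t : t \in I -> t \in S -> nonfull t -> e t y.
  by move=> tI tS nt; have [z D] := arc_f t tI tS; have [] := nonfull_arc t z tI tS nt D.
(* [y] and the labels are adjacent to [t'], so [z] is outside [S]; being adjacent to [f], it is
   outside the component of [c], which [t] then dominates. *)
have no_arc t t' z : t \in I -> t \in S -> nonfull t -> t' \in I -> t' \in S ->
    nonfull t' -> ~ dom2 t z t'.
  move=> tI tS nt t'I t'S nt' D; have [_ zt'] := dom2_Ne D.
  have zI := arc_notin tI D; have [zS|zS] := boolP (z \in S).
    case: (label_cases zS zI) => [zy|[b [bI bS bf zx]]].
      by rewrite zy e_sym nonfull_y in zt'.
    by rewrite zx label_cut in zt'.
  have cz : ~~ same c z.
    by apply: (adjJ z f) => //; apply: arc_adj D _ _; rewrite // eq_sym neqS.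
  case/existsP: nt => v /and3P[vS cv /negP[]].
  apply: (dom2_full (dom2C D)) => //; [by rewrite eq_sym neqS | exact: sep].
(* At most one such [t] exists by [arc_total] and [no_arc], and at least one by
   [no_full_but_one]. *)
have [t [tI tS nt full]] : exists t, [/\ t \in I, t \in S, nonfull t &
    forall s v, s \in S -> s != y -> s != t -> v \notin S -> same c v -> e s v].
  have [t /and3P[tI tS nt]|none] := pickP [pred t | [&& t \in I, t \in S & nonfull t]].
    exists t; split=> // s v sS sy st vS cv; have [sI|sI] := boolP (s \in I); last first.
      by have [b [bI bS bf ->]] := x_onto sS sI sy; apply: xfull.
    apply: fullP => //; apply/negP=> ns.
    by case: (arc_total sI tI st) => -[z]; apply: no_arc.
  case: (no_full_but_one cS yS) => s v sS sy vS cv; have [sI|sI] := boolP (s \in I).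
    by apply: fullP => //; have := none s; rewrite /= sI sS /= => ->.
  by have [b [bI bS bf ->]] := x_onto sS sI sy; apply: xfull.
have [z Dz] := arc_f t tI tS.
have [ety] := nonfull_arc t z tI tS nt Dz.
have ntf := I_indep tI fI.
have fcS v : v \notin S -> same c v -> [/\ v \notin S, f \notin S & ~~ same v f].
  by move=> vS cv; split=> //; rewrite same_sym fc.
have miss_y v : v \notin S -> same c v -> e t v -> ~~ e y v.
  move=> vS cv tv; apply/negP=> yv; apply: (@no_common_nbr v) => s sS.
  have [->//|sy] := eqVneq s y; have [->//|st] := eqVneq s t; exact: full.
have covNS s v : s \in S -> v \notin S -> ~~ e s v -> ~~ N v s.
  by move=> sS vS nsv; apply: covN; [rewrite eq_sym neqS | rewrite e_sym].
case=> [zy|[zS cz zy onlyf]].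
  (* Case [(t, y; f)]: a neighbour [v'] of [t] in the component of [c] misses [y], and its arc to
     [f] runs through a vertex of [I], which forces [f] to be the only vertex of [I] outside [S]. *)
  rewrite {z}zy in Dz; have [_ yf] := dom2_Ne Dz.
  have [v' [v'S cv' tv']] := nbr_of_cut tS cS.
  have yv' := miss_y v' v'S cv' tv'.
  have [r [rI rS Dr]] : exists z, [/\ z \in I, z \in S & dom2 v' z f].
    have [_ _ v'f] := fcS v' v'S cv'.
    case: (crit_far v'S fS v'f) => [dom|[z zS D]|[z zS D]].
    - by move: (dom y); rewrite !(negPf (covNS y _ _ _ _)).
    - have [ev'z _ _ _] := D; have [_ zf] := dom2_Ne D.
      have [zI|zI] := boolP (z \in I); first by exists z.
      case: (label_cases zS zI) => [zy|[b [bI bS bf zx]]].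
        by rewrite zy e_sym (negPf yv') in ev'z.
      by rewrite zx label_base in zf.
    have [efz _ _ _] := D; have [_ zv'] := dom2_Ne D.
    have zI := arc_notin fI D.
    case: (label_cases zS zI) => [zy|[b [bI bS bf zx]]].
      by rewrite zy e_sym (negPf yf) in efz.
    by rewrite zx xfull in zv'.
  have onlyf b : b \in I -> b \notin S -> b = f.
    move=> bI bS; apply/eqP; apply: contraT => bf.
    have : N r b.
      apply: dom2_cov Dr bf (diff_covN v'S bS _).
      by apply: contra (noC b bI bS) => v'b; apply: same_trans v'b.
    by rewrite /cov (negPf (I_indep rI bI)) (negPf (neqS rS bS)).
  have S_sub s : s \in S -> s != y -> s \in I.
    move=> sS sy; apply: contraT => sI; have [b [bI bS /eqP[]]] := x_onto sS sI sy.
    exact: onlyf.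
  have [v [vS cv yv]] := nbr_of_cut yS cS.
  have tv : ~~ e t v by apply: contraL yv; apply: miss_y.
  have Dy : dom2 v y f.
    have [_ _ vf] := fcS v vS cv.
    case: (crit_far vS fS vf) => [dom|[s sS D]|[s sS D]].
    - by move: (dom t); rewrite !(negPf (covNS t _ _ _ _)).
    - have [<-//|sy] := eqVneq s y.
      have sI := S_sub s sS sy; have [evs _ _ _] := D.
      have st : s != t by apply: contraTneq evs => ->; rewrite e_sym.
      have : N s t by apply: dom2_cov D (neqS tS fS) (covNS t v _ _ _).
      by rewrite /cov (negPf (I_indep sI tI)) (negPf st).
    have [efs _ _ _] := D; have [_ sv] := dom2_Ne D.
    have [sy|sy] := eqVneq s y; first by rewrite sy yv in sv.
    by have := I_indep fI (S_sub s sS sy); rewrite efs.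
  (* Only [t] in [S] misses [v], so the arc ending at [v] is [(t, r'; v)]; then [r'] is adjacent to
     all of [S], to [y] because of the arc [(v, y; f)]. *)
  have [s [r' [sS D]]] := crit_vertexS v; have [sv r'v] := dom2_Ne D.
  have only_t s' : s' \in S -> ~~ e s' v -> s' = t.
    move=> s'S s'v; apply/eqP; apply: contraNT s'v => s't.
    by have [->//|s'y] := eqVneq s' y; apply: full.
  rewrite {s sS sv}(only_t s sS sv) in D; have [etr' _ _ _] := D.
  have r'S : r' \notin S.
    by apply: contraTN etr' => r'S; rewrite (only_t r' r'S r'v) e_irr.
  have er'f : e r' f.
    apply: cov_e; first by apply: contraTneq etr' => ->.
    apply: dom2_cov D _ (covN (neqS tS fS) ntf).
    by rewrite eq_sym; apply: (ltI v f).
  apply: (@no_common_nbr r') => s' s'S.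
  have [->//|s't] := eqVneq s' t.
  have [->|s'y] := eqVneq s' y.
    apply: (dom2_full Dy) => //; first exact: e_neq.
    apply: contra (adjJ r' f r'S fI fS er'f); exact: same_trans.
  by rewrite e_sym; apply: arc_adj D _ _ => //; [exact: S_sub | exact: neqS].
(* Case [z] in the component of [c]: again [f] is the only vertex of [I] outside [S], so [2 < #|I|]
   gives a further [t'] in [S]. *)
have S_sub s : s \in S -> s != y -> s \in I.
  move=> sS sy; apply: contraT => sI; have [b [bI bS /eqP[]]] := x_onto sS sI sy.
  exact: onlyf.
have /set0Pn[t'] : I :\ t :\ f != set0.
  rewrite -card_gt0; have := cardsD1 f (I :\ t); have := cardsD1 t I.
  by rewrite tI !inE fI eq_sym neqS // => h1 h2; move: I_gt2; rewrite h1 h2.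
rewrite !inE => /and3P[t'f t't t'I].
have t'S : t' \in S.
  by apply: contraNT t'f => t'S; apply/eqP; apply: onlyf.
have adjf r a b : a \in I -> b \in I -> b \in S -> dom2 a r b -> e r f.
  by move=> aI bI bS D; apply: arc_adj D _ _; rewrite // eq_sym neqS.
(* The middle vertex would lie neither in [S] nor in the component of [c], so [z] could not cover
   it. *)
have t't_no r : ~ dom2 t' r t.
  move=> D; have [_ rt] := dom2_Ne D; have rf := adjf _ _ _ t'I tI tS D.
  have rI := arc_notin t'I D; have [rS|rS] := boolP (r \in S).
    case: (label_cases rS rI) => [ry|[b [bI bS bf rx]]].
      by rewrite ry e_sym ety in rt.
    by rewrite rx label_cut in rt.
  have cr := adjJ r f rS fI fS rf.
  have : N z r.
    by apply: dom2_cov Dz (e_neq rf) (covN (neqS tS rS) _); rewrite e_sym.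
  by rewrite (negPf (diff_covN zS rS _)) // same_sym sep.
have [r Dr] : exists r, dom2 t r t'.
  by case: (arc_total t'I tI t't) => // -[r /t't_no].
have [_ rt'] := dom2_Ne Dr; have rf := adjf _ _ _ tI t'I t'S Dr.
have ry : r = y.
  have rI := arc_notin tI Dr; have [rS|rS] := boolP (r \in S).
    case: (label_cases rS rI) => [//|[b [bI bS bf rx]]].
    by rewrite rx label_cut in rt'.
  case/existsP: nt => v /and3P[vS cv /negP[]].
  apply: (dom2_full (dom2C Dr)) => //; first by rewrite eq_sym neqS.
  by apply: sep cv; apply: (adjJ r f).
rewrite {r}ry in Dr rt' rf.
(* Since [y] is adjacent to [f] but misses [t'], the middle vertex [r] lies outside [S] and is
   adjacent to all of [S]. *)
have [r D] := arc_f t' t'I t'S; have [_ nrf] := dom2_Ne D; have [et'r _ _ _] := D.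
have rI := arc_notin t'I D.
have rS : r \notin S.
  apply: contraNN nrf => rS.
  by case: (label_cases rS rI) => [->//|[b [bI bS bf ->]]]; apply: label_base.
apply: (@no_common_nbr r) => s sS; have [->|sy] := eqVneq s y; last first.
  by rewrite e_sym; apply: arc_adj D _ _ => //; [exact: S_sub | exact: neqS].
rewrite e_sym; apply: cov_e; first by rewrite eq_sym neqS.
apply: dom2_cov D (neqS yS fS) (covN _ _); last by rewrite e_sym.
by apply: contraNneq yI => <-.
Qed.

(* Every vertex of C outside I misses y, which forces an arc (t, w; f) with w in C;
   then w and a neighbour u of f outside S both miss only y. *)
Lemma no_labelling_meeting_I g : g \in I -> g \notin S -> same c g -> False.
Proof.
move=> gI gS cg.
have gf : g != f by apply: contraNneq cf => <-.
have fg : ~~ same f g.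
  by apply: contra cf => fg; apply: same_trans cg _; rewrite same_sym.
have far_I w : w \notin S -> exists b, [/\ b \in I, b \notin S & ~~ N w b].
  move=> wS; have [fw|fw] := boolP (same f w).
    exists g; split=> //; apply: diff_covN => //.
    by apply: contra fg; apply: same_trans.
  by exists f; split=> //; apply: diff_covN; rewrite // same_sym.
have T_far t r v b : t \in I -> t \in S -> b \in I -> b \notin S -> dom2 t r v -> b != v ->
    ~~ N r b -> False.
  move=> tI tS bI bS D bv; apply/negP/negPn.
  by apply: dom2_cov D bv (covN (neqS tS bS) (I_indep tI bI)).
have J_far r : r \notin S -> exists b, [/\ b \in I, b \notin S & ~~ e r b].
  move=> /far_I[b [bI bS]]; rewrite /cov negb_or => /andP[_ nrb]; by exists b.
have covNS s v : s \in S -> v \notin S -> ~~ e s v -> ~~ N v s.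
  by move=> sS vS nsv; apply: covN; [rewrite eq_sym neqS | rewrite e_sym].
(* Labels are adjacent to [v]. An arc ending at [v] and avoiding [y] would join a vertex of [I] in
   [S] to one outside [S], and some vertex of [I] outside [S] is covered by neither. *)
have yC v : v \notin S -> v \notin I -> same c v -> ~~ e y v.
  move=> vS vI cv; have [s [r [sS D]]] := crit_vertexS v.
  have xv b : b \in I -> b \notin S -> b != f -> e (x b) v.
    by move=> bI bS bf; apply: label_full => //; apply: contraNneq vI => ->.
  have Iv b : b \in I -> b != v by move=> bI; apply: contraNneq vI => <-.
  have [sv rv] := dom2_Ne D; have [sI|sI] := boolP (s \in I); last first.
    by case: (label_cases sS sI) sv => [->//|[b [bI bS bf ->]]]; rewrite xv.
  have rI := arc_notin sI D; have [rS|rS] := boolP (r \in S).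
    by case: (label_cases rS rI) rv => [->//|[b [bI bS bf ->]]]; rewrite xv.
  by have [b [bI bS rb]] := far_I r rS; case: (T_far _ _ _ _ sI sS bI bS D (Iv b bI) rb).
have [t [w [tI tS wS wI [cw Dw]]]] : exists t w,
    [/\ t \in I, t \in S, w \notin S, w \notin I & same c w /\ dom2 t w f].
  have [v vS egv] := nbr_outside gS.
  have vI : v \notin I by apply: contraL egv => vI; apply: I_indep.
  have cv : same c v by apply: same_trans cg _; apply: same_adj.
  have vf : ~~ same v f by apply: contra cf; apply: same_trans.
  have yv := yC v vS vI cv.
  have xv b : b \in I -> b \notin S -> b != f -> e (x b) v.
    by move=> bI bS bf; apply: label_full => //; apply: contraNneq vI => ->.
  (* If [y] is adjacent to [f], so is all of [S :\: I], and vertex criticality at [f] gives the arc;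
     otherwise edge criticality for [f] and [v] does. *)
  have [yf|yf] := boolP (e y f).
    have [s [r [sS D]]] := crit_vertexS f; have [sf rf] := dom2_Ne D.
    have Xf z : z \in S -> z \notin I -> e z f.
      by move=> zS zI; case: (label_cases zS zI) => [->//|[b [bI bS bf ->]]]; apply: label_base.
    have sI : s \in I by apply: contraT => sI; rewrite Xf in sf.
    have rI := arc_notin sI D.
    have rS : r \notin S by apply: contraL rf => rS; rewrite Xf.
    exists s, r; split=> //; split=> //; apply: same_trans cg _.
    by rewrite same_sym; apply: same_adj => //; apply: arc_adj D _ _.
  case: (crit_far fS vS _) => [|dom|[z zS D]|[z zS D]]; first by rewrite same_sym.
  - by move: (dom y); rewrite !(negPf (covNS y _ _ _ _)).
  - have [efz _ _ _] := D; have [_ zv] := dom2_Ne D; have zI := arc_notin fI D.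
    case: (label_cases zS zI) => [zy|[b [bI bS bf zx]]].
      by rewrite zy e_sym (negPf yf) in efz.
    by rewrite zx xv in zv.
  have [evz _ _ _] := D; have [_ zf] := dom2_Ne D.
  have [zI|zI] := boolP (z \in I).
    by exists z, v; split=> //; split=> //; apply: dom2C.
  case: (label_cases zS zI) => [zy|[b [bI bS bf zx]]].
    by rewrite zy e_sym (negPf yv) in evz.
  by rewrite zx label_base in zf.
have yw := yC w wS wI cw.
have ty : e t y.
  apply: cov_e; first by apply: contraNneq yI => <-.
  by apply: dom2_cov (dom2C Dw) (neqS yS fS) (covNS _ _ yS wS yw).
have Jc b : b \in I -> b \notin S -> b != f -> same c b.
  move=> bI bS bf; apply: same_trans cw _; apply: same_adj => //.
  exact: (arc_adj tI Dw bI bf).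
have tfull u : u \notin S -> ~~ same c u -> u != f -> e t u.
  move=> uS cu uf; apply: (dom2_full (dom2C Dw)) => //.
  by apply: contra cu; apply: same_trans.
have wS_adj s : s \in S -> s != y -> e s w.
  move=> sS sy; have [sI|sI] := boolP (s \in I).
    by rewrite e_sym; apply: (arc_adj tI Dw sI (neqS sS fS)).
  have [b [bI bS bf ->]] := x_onto sS sI sy; apply: label_full => //.
  by apply: contraNneq wI => ->.
(* An arc ending at [t] contains an element of [S :\: I], by [far_I], and this is not [y], which is
   adjacent to [t]. *)
have [b [r [bI bS bf D]]] : exists b r,
    [/\ b \in I, b \notin S, b != f & dom2 (x b) r t].
  have X_t z : z \in S -> z \notin I -> ~~ e z t ->
      exists b, [/\ b \in I, b \notin S, b != f & z = x b].
    by move=> zS zI; case: (label_cases zS zI) => // ->; rewrite e_sym ty.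
  have [s [r [sS D]]] := crit_vertexS t; have [st rt] := dom2_Ne D.
  have [sI|sI] := boolP (s \in I); last first.
    by have [b [bI bS bf sx]] := X_t s sS sI st; exists b, r; rewrite -sx.
  have rI := arc_notin sI D; have [rS|rS] := boolP (r \in S).
    have [b [bI bS bf rx]] := X_t r rS rI rt; exists b, s; rewrite -rx.
    by split=> //; apply: dom2C.
  have [b [bI bS rb]] := far_I r rS; case: (T_far _ _ _ _ sI sS bI bS D _ rb).
  by rewrite eq_sym neqS.
have [exr _ _ _] := D; have [xt rt] := dom2_Ne D.
have bt : b != t by rewrite eq_sym neqS.
have tb : t != b by rewrite eq_sym.
have xb := label_miss bI bS bf.
have xbS := label_in bI bS bf.
have erb : e r b.
  apply: cov_e; first by apply: contraTneq exr => ->.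
  by apply: dom2_cov D bt (covN (neqS xbS bS) xb).
have [z Dz] : exists z, dom2 t z b.
  case: (arc_total tI bI tb) => // -[z D2]; have [_ zt] := dom2_Ne D2.
  have zS := dom2_inS D2 bS; have zI := arc_notin bI D2.
  case: (label_cases zS zI) => [zy|[b' [b'I b'S b'f zx]]].
    by rewrite zy e_sym ty in zt.
  by rewrite zx label_cut in zt.
have [etz _ _ _] := Dz; have [_ zb] := dom2_Ne Dz; have zI := arc_notin tI Dz.
(* If [z] is in [S], it must be [y]. Otherwise [b] and [f] exhaust [I] outside [S], and no [r] can
   satisfy the arc [(x b, r; t)]. *)
have yb : ~~ e y b.
  have [zS|zS] := boolP (z \in S).
    case: (label_cases zS zI) => [<-//|[b' [b'I b'S b'f zx]]].
    have [bb'|bb'] := eqVneq b b'; first by rewrite zx -bb' e_sym (negPf xt) in etz.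
    by rewrite zx label_adj in zb.
  have ezf : e z f by apply: (arc_adj tI Dz fI); rewrite eq_sym.
  have cz : ~~ same c z.
    by apply: contra cf => cz; apply: same_trans cz _; apply: same_adj.
  have onlyb b' : b' \in I -> b' \notin S -> b' != f -> b' = b.
    move=> b'I b'S b'f; apply/eqP; apply: contraNT cz => b'b.
    apply: same_trans (Jc b' b'I b'S b'f) _; rewrite same_sym; apply: same_adj => //.
    exact: (arc_adj tI Dz b'I b'b).
  have rI : r \notin I by apply: contraL erb => rI; apply: I_indep.
  have [rS|rS] := boolP (r \in S).
    case: (label_cases rS rI) => [ry|[b' [b'I b'S b'f rx]]].
      by rewrite ry e_sym ty in rt.
    by rewrite rx (onlyb b') // e_irr in exr.
  have crb : same c r.
    by apply: same_trans (Jc b bI bS bf) _; rewrite same_sym; apply: same_adj.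
  have : e t r.
    apply: (dom2_full (dom2C Dz)) => //; first exact: e_neq.
    by apply: contra cz => zr; apply: same_trans crb _; rewrite same_sym.
  by rewrite e_sym (negPf rt).
have X_miss z' : z' \in S -> z' \notin I ->
    exists b', [/\ b' \in I, b' \notin S, b' != f & ~~ e z' b'].
  move=> z'S z'I; case: (label_cases z'S z'I) => [->|[b' [b'I b'S b'f ->]]].
    by exists b.
  by exists b'; split=> //; apply: label_miss.
(* Every candidate [z'] misses a vertex of [I] outside [S], but [arc_adj] makes it adjacent to all
   of them. *)
have no_arc t' t'' z' : t' \in I -> t' \in S -> t'' \in I -> t'' \in S -> ~ dom2 t' z' t''.
  move=> t'I t'S t''I t''S D'; have z'I := arc_notin t'I D'.
  have [b' [b'I b'S /negP[]]] : exists b', [/\ b' \in I, b' \notin S & ~~ e z' b'].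
    have [z'S|/J_far//] := boolP (z' \in S).
    by have [b' [? ? _ ?]] := X_miss z' z'S z'I; exists b'.
  by apply: (arc_adj t'I D' b'I); rewrite eq_sym neqS.
have only_t t' : t' \in I -> t' \in S -> t' = t.
  move=> t'I t'S; apply/eqP; apply: contraT => t't.
  by case: (arc_total t'I tI t't) => -[z' /no_arc[]].
have [u uS efu] := nbr_outside fS.
have fu : same f u by apply: same_adj.
have cu : ~~ same c u.
  by apply: contra cf => cu; apply: same_trans cu _; rewrite same_sym.
have uc v : same c v -> ~~ same u v.
  by move=> cv; apply: contra cu => uv; apply: same_trans cv _; rewrite same_sym.
have tu : e t u by apply: tfull => //; rewrite eq_sym e_neq.
have diff b' : b' \in I -> b' \notin S -> b' != f -> ~~ N u b'.
  by move=> b'I b'S b'f; apply: diff_covN => //; apply/uc/Jc.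
have b'N b' d : b' \in I -> d \in I -> d != b' -> ~~ N b' d.
  by move=> b'I dI db'; apply: covN; [rewrite eq_sym | apply: I_indep].
(* Otherwise edge criticality gives an arc between [u] and [b']. From [u], the middle vertex [t]
   leaves [x b'] or [b] uncovered, [y] leaves [w], and no label fits; from [b'], [X_miss]
   contradicts [arc_adj]. *)
have xu b' : b' \in I -> b' \notin S -> b' != f -> e (x b') u.
  move=> b'I b'S b'f; have cb' := Jc b' b'I b'S b'f.
  apply: contraT => xu; have xb'S := label_in b'I b'S b'f; have xb' := label_miss b'I b'S b'f.
  case: (crit_far uS b'S (uc _ cb')) => [dom|[z' z'S D']|[z' z'S D']].
  - by move: (dom (x b')); rewrite !(negPf (covNS (x b') _ _ _ _)).
  - have [euz' _ _ _] := D'; have [_ z'b'] := dom2_Ne D'.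
    have [z'I|z'I] := boolP (z' \in I).
      rewrite (only_t z' z'I z'S) in D'; have [bb'|bb'] := eqVneq b b'.
        have : N t (x b').
          by apply: dom2_cov D' (neqS xb'S b'S) (covNS _ _ xb'S uS xu).
        rewrite -bb' /cov e_sym (negPf xt) orbF => /eqP tx.
        by have [/misses_onlyP[[_]]] := x_misses bI bS bf; rewrite -tx tI.
      by have := T_far _ _ _ _ tI tS bI bS (dom2C D') bb' (diff b bI bS bf).
    case: (label_cases z'S z'I) => [z'y|[b'' [b''I b''S b''f z'x]]].
      have wb' : w != b' by apply: contraNneq wI => ->.
      have : N z' w by apply: dom2_cov D' wb' (diff_covN uS wS (uc _ cw)).
      by rewrite z'y /cov (negPf yw) (negPf (neqS yS wS)).
    have [b'b''|b'b''] := eqVneq b' b''.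
      by rewrite z'x -b'b'' e_sym (negPf xu) in euz'.
    by rewrite z'x label_adj in z'b'.
  have z'I := arc_notin b'I D'.
  have [d [dI dS df /negP[]]] := X_miss z' z'S z'I.
  apply: (arc_adj b'I D' dI); apply: contraTneq (Jc d dI dS df) => ->; exact: cu.
have S_u s : s \in S -> s != y -> e s u.
  move=> sS sy; have [sI|sI] := boolP (s \in I); first by rewrite (only_t s).
  by have [b' [b'I b'S b'f ->]] := x_onto sS sI sy; apply: xu.
have uy : ~~ e u y.
  apply/negP=> uy; apply: (@no_common_nbr u) => s sS.
  by have [->|sy] := eqVneq s y; [rewrite e_sym | apply: S_u].
apply: (@not_both_miss_one u w y) => //; first exact: uc.
  by rewrite e_sym.
by move=> s sS sy; rewrite S_u // wS_adj.
Qed.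

End Labelled.

(** * Existence of a labelling *)

Lemma no_independent_of_cut_size : False.
Proof.
have /subsetPn[f0 f0I f0S] := introN idP not_sub_cut.
have [f1 /and3P[f1I f1S f01]|all] :=
  pickP [pred g | [&& g \in I, g \notin S & ~~ same f0 g]]; last first.
  (* All of [I :\: S] lies in one component, and [c] is taken in another. *)
  have [c cS f0c] := other_component f0.
  have J_f0 b : b \in I -> b \notin S -> same f0 b.
    by move=> bI bS; have := all b; rewrite /= bI bS => /negbFE.
  have noC b : b \in I -> b \notin S -> ~~ same c b.
    move=> bI bS; apply: contra f0c => cb; apply: same_trans (J_f0 b bI bS) _.
    by rewrite same_sym.
  have [b bI bS cb|f [y [x [[fI fS cf] [yS yI] xP xO]]]] :=
      @cut_labelling c f0 f0I f0S (noC f0 f0I f0S) _.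
    by rewrite (negPf (noC b bI bS)) in cb.
  apply: (no_labelling_avoiding_I cS fI fS cf yS yI xP xO noC) => b bI bS.
  by apply: same_trans (J_f0 b bI bS); rewrite same_sym J_f0.
(* One of the two components has all its vertices of [I] labelled: an unlabelled [b] in that of [f0]
   sends arcs to, and so labels, all vertices of [I] in that of [f1]. *)
have [c [d [[cI cS] [dI dS cd] fed]]] : exists c d,
    [/\ c \in I /\ c \notin S, [/\ d \in I, d \notin S & ~~ same c d]
      & forall b, b \in I -> b \notin S -> same c b -> exists z, misses_only c b z].
  have [b /and4P[bI bS f0b nb]|all] := pickP [pred b |
      [&& b \in I, b \notin S, same f0 b & ~~ [exists z, misses_only f0 b z]]]; last first.
    exists f0, f1; split=> // b bI bS f0b; apply/existsP.
    by have := all b; rewrite /= bI bS f0b => /negbFE.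
  exists f1, f0; split=> //; first by rewrite same_sym.
  move=> a aI aS f1a; have f0a : ~~ same f0 a.
    by apply: contra f01 => f0a; apply: same_trans f0a _; rewrite same_sym.
  have ba : b != a by apply: contraNneq f0a => <-.
  case: (arc_total bI aI ba) => -[z D].
    exists z; apply: (arc_misses_only bI bS _ D).
    by apply: contra f01 => f1b; apply: same_trans f0b _; rewrite same_sym.
  by case/existsP: nb; exists z; apply: (arc_misses_only aI aS f0a D).
have [f [y [x [[fI fS cf] [yS yI] xP xO]]]] := cut_labelling dI dS cd fed.
exact: (no_labelling_meeting_I fI fS cf yS yI xP xO cI cS (same_refl c)).
Qed.

End Independent.
End Cut.

(** * Minima over finite families and small connected sets *)

Lemma bigminn_le (T : finType) (P : pred T) (F : T -> nat) m i :
  P i -> \big[minn/m]_(j | P j) F j <= F i.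
Proof.
move=> Pi; have := mem_index_enum i; elim: (index_enum T) => //= j s IHs.
rewrite inE big_cons => /predU1P[<-|/IHs le_s]; first by rewrite Pi geq_minl.
by case: ifP => // _; rewrite geq_min le_s orbT.
Qed.

(** [n <= m] excludes the default value [m] of the minimum. *)
Lemma bigminn_attained (T : finType) (P : pred T) (F : T -> nat) m n :
  \big[minn/m]_(j | P j) F j < n -> n <= m -> exists2 i, P i & F i < n.
Proof.
move=> lt_n le_m; suff : \big[minn/m]_(j | P j) F j < n -> exists2 i, P i & F i < n by apply.
apply: (big_ind (fun k => k < n -> exists2 i, P i & F i < n)).
- by rewrite ltnNge le_m.
- by move=> k l IHk IHl; rewrite gtn_min => /orP[].
- by move=> i Pi; exists i.
Qed.

Lemma connect_first (T : finType) (r : rel T) x y :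
  connect r x y -> x != y -> exists z, r x z.
Proof.
case/connectP=> [[|z p] /= + ->]; first by rewrite eqxx.
by case/andP=> rxz _ _; exists z.
Qed.

Lemma connected_pair (V : finType) (r : rel V) a b :
  irreflexive r -> connected_set r [set a; b] -> a = b \/ r a b.
Proof.
move=> r_irr /forall_inP/(_ a (set21 a b))/forall_inP/(_ b (set22 a b)) con.
have [->|ab] := eqVneq a b; [by left | right].
have [z /and3P[raz _]] := connect_first con ab.
by case/set2P=> zE; rewrite zE ?r_irr // in raz.
Qed.

Lemma set_le2 (T : finType) (D : {set T}) :
  D != set0 -> #|D| < 3 -> exists a b, D = [set a; b].
Proof.
case/set0Pn=> a aD; rewrite (cardsD1 a) aD add1n !ltnS => le1.
have [D0|[b bD]] := set_0Vmem (D :\ a).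
  by exists a, a; rewrite setUid -(setD1K aD) D0 setU0.
exists a, b; rewrite -(setD1K aD); congr (_ |: _).
by apply/esym/eqP; rewrite eqEcard sub1set bD cards1.
Qed.

(** * From criticality to arcs *)

Section Critical.
Variables (V : finType) (e : rel V).
Hypothesis e_sym : symmetric e.
Hypothesis e_irr : irreflexive e.
Hypothesis e_conn : connected_set e setT.
Hypothesis gamma3 : gammac e setT = 3.
Hypothesis card_V : 3 < #|V|.

Local Notation N := (cov e).

Lemma has_nbr v : exists w, e v w.
Proof.
have /set0Pn[w] : [set~ v] != set0.
  by rewrite -card_gt0 cardsC1; case: #|V| card_V => [|[]].
rewrite !inE => wv.
move: e_conn => /forall_inP/(_ v (in_setT v))/forall_inP/(_ w (in_setT w)) con.
have [|z /and3P[evz _ _]] := connect_first con; first by rewrite eq_sym.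
by exists z.
Qed.

Lemma undominated a b : a = b \/ e a b -> exists w, ~~ N a w && ~~ N b w.
Proof.
move=> ab; apply/existsP; rewrite -[[exists _, _]]negbK negb_exists.
apply/negP=> /forallP dom.
suff : gammac e setT <= #|[set a; b]| by rewrite gamma3 cards2; case: (_ != _).
apply: bigminn_le; apply/and3P; split; first exact: subsetT.
  apply/forall_inP=> w _; move: (dom w); rewrite -negb_or negbK /cov !inE.
  case/orP=> /orP[/eqP->|ew]; rewrite ?eqxx ?orbT //.
    by apply/orP; right; apply/exists_inP; exists a; rewrite ?set21 // e_sym.
  by apply/orP; right; apply/exists_inP; exists b; rewrite ?set22 // e_sym.
apply/forall_inP=> u uD; apply/forall_inP=> v vD.
have [<-|uv] := eqVneq u v; first exact: connect0.
apply: connect1; apply/and3P; split=> //.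
case: ab uD vD uv {dom} => [->|eab].
  by rewrite setUid => /set1P-> /set1P->; rewrite eqxx.
by case/set2P=> -> /set2P[]->; rewrite ?eqxx // e_sym.
Qed.

(** The pair cannot degenerate: if [a] alone dominated everything but [v], then [a] and a neighbour
    of [v] would form a dominating edge. *)
Lemma dom2_intro a b v : a = b \/ e a b -> ~~ N a v -> ~~ N b v ->
  (forall w, w != v -> N a w || N b w) -> dom2 e a b v.
Proof.
move=> [<-|eab] av bv dom; last by split.
have [z evz] := has_nbr v.
have zv : z != v by apply: contraTneq evz => ->; rewrite e_irr.
have eaz : e a z.
  move: (dom z zv); rewrite orbb => /orP[/eqP az|//].
  by move: av; rewrite az /cov e_sym evz orbT.
have [w /andP[aw zw]] := undominated (or_intror eaz).
have [wv|wv] := eqVneq w v; first by rewrite wv /cov e_sym evz orbT in zw.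
by move: (dom w wv); rewrite orbb (negPf aw).
Qed.

(** [3 <= #|W|] rules out the default value [#|W|] of [gammac]; a one-vertex set appears as
    [a = b]. *)
Lemma cds_pair (r : rel V) (W : {set V}) : irreflexive r -> W != set0 -> 3 <= #|W| ->
  gammac r W < 3 -> exists a b, [/\ [set a; b] \subset W, a = b \/ r a b &
    forall w, w \in W -> [|| w == a, w == b, r w a | r w b]].
Proof.
move=> r_irr /set0Pn[w0 w0W] leW /bigminn_attained/(_ leW)[D /and3P[DW dom con] ltD].
have domD w : w \in W -> exists2 y, y \in D & (w == y) || r w y.
  move=> wW; move/forall_inP: dom => /(_ w wW) /orP[wD|/exists_inP[y yD rwy]].
    by exists w; rewrite ?eqxx.
  by exists y; rewrite ?rwy ?orbT.
have [|a [b defD]] := @set_le2 _ D _ ltD.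
  by apply/set0Pn; have [y yD _] := domD w0 w0W; exists y.
rewrite defD in DW con domD; exists a, b; split=> //; first exact: connected_pair.
by move=> w /domD[y /set2P[->|->] /orP[->|->]]; rewrite ?orbT.
Qed.

(** The pair misses some vertex of the whole graph, which can only be [v]. *)
Lemma crit_vertex_dom2 v : gammac e [set~ v] < 3 -> exists a b, dom2 e a b v.
Proof.
have le3 : 3 <= #|[set~ v]| by rewrite cardsC1; case: #|V| card_V.
have W0 : [set~ v] != set0 by rewrite -card_gt0; apply: leq_trans le3.
case/(cds_pair e_irr W0 le3) => a [b [sub ab dom]]; exists a, b.
have domN w : w != v -> N a w || N b w.
  move=> wv; have := dom w; rewrite !inE wv => /(_ isT).
  by rewrite /cov !(eq_sym _ w) !(e_sym _ w) => /or4P[]->; rewrite ?orbT.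
have [w /andP[aw bw]] := undominated ab.
have [wv|wv] := eqVneq w v; first by apply: dom2_intro; rewrite -?wv // wv.
by move: (domN w wv); rewrite (negPf aw) (negPf bw).
Qed.

(** If [u] and [v] miss a common vertex, the pair dominating the graph with [uv] added is not the
    new edge itself. A vertex that it misses in [e] is then dominated through the new edge, so it is
    one end of that edge and the pair contains the other. *)
Lemma crit_edge_dom2 u v : gammac (add_edge e u v) setT < 3 -> ~~ N u v ->
  [\/ forall w, N u w || N v w, exists z, dom2 e u z v | exists z, dom2 e v z u].
Proof.
move=> ltg; rewrite /cov negb_or => /andP[uv nuv].
have irr' : irreflexive (add_edge e u v).
  move=> w; apply/negP=> /or3P[|/andP[/eqP-> /eqP vu]|/andP[/eqP-> /eqP vu]].
  - by rewrite e_irr.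
  - by rewrite vu eqxx in uv.
  by rewrite vu eqxx in uv.
have [||a [b [_ ab dom]]] := cds_pair irr' _ _ ltg.
- by rewrite -card_gt0 cardsT; apply: leq_trans card_V.
- by rewrite cardsT ltnW.
have {}dom w : [|| w == a, w == b, add_edge e u v w a | add_edge e u v w b].
  exact: dom.
have [/forallP|] := boolP [forall w, N u w || N v w]; first by move=> ?; apply: Or31.
rewrite negb_forall => /existsP[w0]; rewrite negb_or => /andP[].
rewrite /cov !negb_or => /andP[uw0 nuw0] /andP[vw0 nvw0].
have {}ab : a = b \/ e a b.
  case: ab => [->|/or3P[eab|/andP[/eqP aE /eqP bE]|/andP[/eqP aE /eqP bE]]];
    try (by left); try (by right);
  move: (dom w0); rewrite aE bE /add_edge /= !(eq_sym w0) (negPf uw0) (negPf vw0) /= !(e_sym w0);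
  by rewrite (negPf nuw0) (negPf nvw0).
have endpoint p q w : p = q \/ e p q ->
    (forall w, [|| w == p, w == q, add_edge e u v w p | add_edge e u v w q]) ->
    ~~ N p w -> ~~ N q w -> ~~ e w p -> add_edge e u v w p ->
    (exists z, dom2 e u z v) \/ (exists z, dom2 e v z u).
  move=> pq {}dom pw qw nwp /= /or3P[|/andP[/eqP wE /eqP pE]|/andP[/eqP wE /eqP pE]].
  - by rewrite (negPf nwp).
  - right; exists q; rewrite -wE -pE; apply: dom2_intro => // w' w'w.
    rewrite /cov !(eq_sym _ w') !(e_sym _ w').
    case/or4P: (dom w'); rewrite /add_edge /=; [by move->|by move->; rewrite orbT| |];
      by rewrite -wE -pE (negPf w'w) /= => /orP[->|/andP[->]]; rewrite ?orbT.
  left; exists q; rewrite -wE -pE; apply: dom2_intro => // w' w'w.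
  rewrite /cov !(eq_sym _ w') !(e_sym _ w').
  case/or4P: (dom w'); rewrite /add_edge /=; [by move->|by move->; rewrite orbT| |];
    by rewrite -wE -pE (negPf w'w) /= ?orbF => /orP[->|/andP[->]]; rewrite ?orbT.
have [w /andP[aw bw]] := undominated ab.
have [naw nbw] : ~~ e w a /\ ~~ e w b.
  by move: aw bw; rewrite /cov !negb_or !(e_sym w) => /andP[_ ->] /andP[_ ->].
suff [] : (exists z, dom2 e u z v) \/ (exists z, dom2 e v z u).
- exact: Or32.
- exact: Or33.
have ba : b = a \/ e b a by rewrite e_sym; case: ab; [left | right].
case/or4P: (dom w) => [/eqP wa|/eqP wb|ewa|ewb].
- by rewrite wa /cov eqxx in aw.
- by rewrite wb /cov eqxx in bw.
- exact: endpoint ab dom aw bw naw ewa.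
apply: endpoint ba _ bw aw nbw ewb => w'.
by case/or4P: (dom w') => ->; rewrite ?orbT.
Qed.

End Critical.

(** * Minimum cuts and the theorem *)

Lemma nbr_outside_cut (V : finType) (e : rel V) (S : {set V}) u :
  component e (~: S) u != [set u] -> u \notin S -> exists2 v, v \notin S & e u v.
Proof.
move=> nsingle uS.
have [v /andP[vu]|none] := pickP [pred v | (v != u) && (v \in component e (~: S) u)].
  rewrite inE => /andP[_ con].
  have [|z /and3P[euz _ zS]] := connect_first con; first by rewrite eq_sym.
  by exists z; rewrite // -in_setC.
case/negP: nsingle; apply/eqP/setP=> v; have := none v; rewrite /= !inE.
by have [->|_ /= ->//] := eqVneq v u; rewrite uS connect0.
Qed.

Lemma connect_restr_sym (V : finType) (e : rel V) (W : {set V}) :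
  symmetric e -> symmetric (connect (restr e W)).
Proof.
move=> e_sym; apply: sym_connect_sym => a b.
by rewrite /restr /= e_sym [X in _ && X]andbC.
Qed.

(** If [s] had no neighbour in the component of [u], then [S :\ s] would still separate that
    component, against minimality. *)
Lemma nbr_of_min_cut (V : finType) (e : rel V) (S : {set V}) s u :
  symmetric e -> #|S| = kappa e -> vertex_cut e S -> s \in S -> u \notin S ->
  exists v, [/\ v \notin S, connect (restr e (~: S)) u v & e s v].
Proof.
move=> e_sym minS cutS sS uS.
set same := connect _; have [v /and3P[vS suv esv]|none] :=
  pickP [pred v | [&& v \notin S, same u v & e s v]]; first by exists v.
have [v vS nuv] : exists2 v, v \notin S & ~~ same u v.
  have same_sym : symmetric same.
    exact: connect_restr_sym.
  move: cutS; rewrite /vertex_cut negb_forall_in => /exists_inP[a]; rewrite inE => aS.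
  rewrite negb_forall_in => /exists_inP[b]; rewrite inE => bS nab.
  have [ua|ua] := boolP (same u a); last by exists a.
  exists b => //; apply: contra nab => ub; apply: connect_trans ub.
  by rewrite -/same same_sym.
(* A walk avoiding [S :\ s] could leave the component only through [s]. *)
have closed p w : same u w -> w \notin S -> path (restr e (~: (S :\ s))) w p ->
    same u (last w p).
  elim: p w => //= w' p IHp w uw wS /andP[/and3P[eww' _ w'S] path_p].
  have {}w'S : w' \notin S.
    have [w's|w's] := eqVneq w' s.
      by have := none w; rewrite /= wS uw e_sym -w's eww'.
    by move: w'S; rewrite !inE w's.
  apply: IHp path_p => //; apply: connect_trans uw (connect1 _).
  by rewrite /restr /= eww' !inE wS.
have cut' : vertex_cut e (S :\ s).
  apply/negP=> /forall_inP/(_ u); rewrite !inE negb_and uS orbT => /(_ isT).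
  move/forall_inP/(_ v); rewrite !inE negb_and vS orbT => /(_ isT)/connectP[p path_p vE].
  by case/negP: nuv; rewrite vE; apply: closed path_p => //; apply: connect0.
have : kappa e <= #|S :\ s| by apply: bigminn_le.
by rewrite -minS (cardsD1 s S) sS ltnn.
Qed.

Theorem theorem4p6 (V : finType) (e : rel V) :
  simple_graph e -> connected_set e setT ->
  maximal_vertex_critical e 3 ->
  alpha e = kappa e ->
  forall S : {set V}, #|S| = kappa e -> vertex_cut e S ->
  exists2 x, x \notin S & component e (~: S) x = [set x].
Proof.
move=> [e_sym e_irr] e_conn [[gamma3 e_crit] [[_ con2] [_ v_crit]]] alpha_kappa S minS cutS.
have [x /andP[label_in /eqP single]|none] :=
  pickP [pred x | (x \notin S) && (component e (~: S) x == [set x])]; first by exists x.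
exfalso; pose same := connect (restr e (~: S)).
have same_sym : symmetric same.
  exact: connect_restr_sym.
have same_refl : reflexive same by move=> a; apply: connect0.
have same_trans : transitive same by move=> a b d; apply: connect_trans.
have same_adj u v : u \notin S -> v \notin S -> e u v -> same u v.
  by move=> uS vS euv; apply: connect1; rewrite /restr /= !inE uS vS euv.
have nbr_out u : u \notin S -> exists2 v, v \notin S & e u v.
  move=> uS; apply: (nbr_outside_cut _ uS).
  by have := none u; rewrite /= uS /= => ->.
have [a [b [aS bS nab]]] : exists a b, [/\ a \notin S, b \notin S & ~~ same a b].
  move: cutS; rewrite /vertex_cut negb_forall_in => /exists_inP[a]; rewrite inE => aS.
  rewrite negb_forall_in => /exists_inP[b]; rewrite inE => bS nab.
  by exists a, b.
have other u : exists2 v, v \notin S & ~~ same u v.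
  have [ua|ua] := boolP (same u a); last by exists a.
  exists b => //; apply: contra nab => ub; apply: same_trans ub.
  by rewrite same_sym.
have S_ge2 : 1 < #|S| by rewrite ltnNge -ltnS; apply: contra cutS; apply: con2.
have card_V : 3 < #|V|.
  have ab : a != b by apply: contraNneq nab => ->.
  rewrite -(cardsC S) -addn2 in S_ge2 *; apply: (@leq_add 2 2) => //.
  rewrite (cardsD1 a) (cardsD1 b) !inE aS bS eq_sym ab //.
have nbr_cut s u : s \in S -> u \notin S -> exists v, [/\ v \notin S, same u v & e s v].
  exact: nbr_of_min_cut.
have vc v : exists a b, dom2 e a b v by apply: crit_vertex_dom2.
have ec u v : ~~ cov e u v -> [\/ forall w, cov e u w || cov e v w,
    exists z, dom2 e u z v | exists z, dom2 e v z u].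
  move=> nuv; apply: crit_edge_dom2 => //; move: nuv.
  by rewrite /cov negb_or => /andP[]; apply: e_crit.
have [I I_indep card_I] : exists2 I : {set V}, independent e I & #|I| = #|S|.
  have [|I indI] := @eq_bigmax_cond _ (independent e) (fun I : {set V} => #|I|).
    by apply/card_gt0P; exists set0; apply/forall_inP=> v; rewrite inE.
  by rewrite -/(alpha e) alpha_kappa -minS; exists I.
have {}I_indep u v : u \in I -> v \in I -> ~~ e u v.
  by move=> uI vI; move/forall_inP/(_ u uI)/forall_inP/(_ v vI): I_indep.
have S_neq2 := card_cut_neq2 e_sym e_irr same_refl same_sym same_trans same_adj other nbr_out nbr_cut vc.
have I_gt2 : 2 < #|I|.
  by rewrite card_I ltn_neqAle S_ge2 andbT; apply/negP=> /eqP/esym.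
exact: (no_independent_of_cut_size e_sym e_irr same_refl same_sym same_trans same_adj
  other nbr_out nbr_cut vc ec I_indep card_I I_gt2).
Qed.
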